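(* Let $(M,g)$ be an oriented Riemannian 4-manifold with a metric connection $D$, and let $SM$ carry the associated $G_2$ structure $\phi$. Let $(d*\phi)_{\mathrm{tors}}=-\beta\wedge\sigma-(\mu T)\wedge\alpha_1+\mu\wedge(T\alpha_1)$ be the torsion part of $d*\phi$. Then $(d*\phi)_{\mathrm{tors}}=\tau_{1,\mathrm{tors}}\wedge*\phi+*\tau_{2,\mathrm{tors}}$, where $\tau_{2,\mathrm{tors}}\in\Omega^2_{14}$, $$\tau_{1,\mathrm{tors}}=\tfrac13\sum_{i=0}^3W_ie^i$$ and $$\begin{aligned}\tau_{2,\mathrm{tors}}=\;&(\tfrac13W_3-Z_{321})e^{06}-(\tfrac13W_2-Z_{230})e^{16}+(\tfrac13W_1-Z_{103})e^{26}-(\tfrac13W_0-Z_{012})e^{36}\\&+(\tfrac13W_2-Z_{213})e^{05}+(\tfrac13W_3-Z_{302})e^{15}-(\tfrac13W_0-Z_{031})e^{25}-(\tfrac13W_1-Z_{120})e^{35}\\&+(\tfrac13W_1-Z_{132})e^{04}-(\tfrac13W_0-Z_{023})e^{14}-(\tfrac13W_3-Z_{310})e^{24}+(\tfrac13W_2-Z_{201})e^{34}.\end{aligned}$$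
   Context: Setting. $(M,g)$ is an oriented Riemannian 4-manifold, $\langle\,,\rangle=g$, $D$ is a linear connection on $TM$ with $Dg=0$, with torsion $T^D(X,Y)=D_XY-D_YX-[X,Y]$. $SM=\{u\in TM:\|u\|=1\}$, $f:SM\to M$ is the projection, and $U$ is the section of $f^*TM$ with $U_u=u$. One has $T\,SM=\mathcal V\oplus\mathcal H$ with $\mathcal V=\ker df$, $\mathcal H=\{X:(f^*D)_XU=0\}$; $\mathcal H_u\simeq T_{f(u)}M$ via $df$ and $\mathcal V_u\simeq u^\perp\subset T_{f(u)}M$ via $X\mapsto (f^*D)_XU$. $SM$ carries the metric (still $g$) for which $\mathcal H\perp\mathcal V$ and both identifications are isometries. Adapted frame. At $u\in SM$ take a direct orthonormal basis $e_0=u,e_1,e_2,e_3$ of $T_{f(u)}M$; the same symbols denote its horizontal lift to $\mathcal H_u$, and $e_{i+3}\in\mathcal V_u$ ($i=1,2,3$) denotes the vertical vector corresponding to $e_i$. $e^0,\dots,e^6$ is the dual coframe, $e^{ij\cdots}=e^i\wedge e^j\wedge\cdots$, and $SM$ is oriented by $e^{0123456}$; $*$ is the Hodge operator of $SM$. The following forms do not depend on the adapted frame: $\mu=e^0$, $\beta=e^{14}+e^{25}+e^{36}$, $\alpha=e^{456}$, $\alpha_1=e^{156}+e^{264}+e^{345}$, $\alpha_2=e^{126}+e^{234}+e^{315}$, $\mathrm{vol}=f^*\mathrm{vol}_M=e^{0123}$. The $G_2$ structure is $\phi=\alpha+\mu\wedge\beta-\alpha_2$, with $*\phi=\mathrm{vol}-\frac12\beta^2-\mu\wedge\alpha_1$.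 $\Omega^2_{14}=\{\gamma\in\Omega^2:\gamma\wedge\phi=*\gamma\}$. Torsion quantities. $T_{ijk}=\langle T^D(e_i,e_j),e_k\rangle$ for $0\le i,j,k\le3$; $\mu T=\sum_{0\le i<j\le3}T_{ij0}e^{ij}$; $\sigma=\sum_{0\le i<j\le3}(T_{ij1}e^{ij4}+T_{ij2}e^{ij5}+T_{ij3}e^{ij6})$; $T\alpha_1=\sum_{0\le i<j\le3}(T_{ij1}e^{ij56}+T_{ij2}e^{ij64}+T_{ij3}e^{ij45})$. For an even permutation (direct ordering) $(i,j,k,l)$ of $(0,1,2,3)$: $Z_{ijk}=T_{ijj}+T_{ikk}+T_{jkl}$ (no summation) and $W_i=Z_{ijk}+Z_{ilj}+Z_{ikl}$. *)

(* Defs.v *)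
From HB Require Import structures.
From mathcomp Require Import all_boot all_order all_algebra all_fingroup.
From mathcomp Require Import all_classical all_reals all_analysis.

Set Implicit Arguments.
Unset Strict Implicit.
Unset Printing Implicit Defensive.

Import Order.TTheory GRing.Theory Num.Theory.
Import numFieldNormedType.Exports.

Local Open Scope classical_set_scope.
Local Open Scope ring_scope.

(** * Smooth 4-manifolds

    Tangent vectors at [p] are the derivations at [p] of the algebra of globally
    defined smooth functions. They live in the ambient vector space [tfun] of
    all functionals on [M -> R]; requiring them to vanish on the functions that
    are not smooth makes a derivation the same thing as an element of [tfun]. *)

Section Manifold.
Context {R : realType} {M : topologicalType}.

Fixpoint Ck_on (k : nat) (A : set 'rV[R]_4) (f : 'rV[R]_4 -> R) : Prop :=
  match k with
  | 0 => forall x, A x -> {for x, continuous f}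
  | k'.+1 => (forall x, A x -> differentiable f x) /\
             (forall j : 'I_4, Ck_on k' A (fun x => 'D_(delta_mx 0 j) f x))
  end.

Definition smooth_on (A : set 'rV[R]_4) (f : 'rV[R]_4 -> R) : Prop :=
  forall k, Ck_on k A f.

(** Only the restrictions of [cmap] to [cdom] and of [cinv] to the image of
    [cdom] are meaningful. *)
Record chart := Chart {
  cdom : set M;
  cmap : M -> 'rV[R]_4;
  cinv : 'rV[R]_4 -> M }.

Definition is_chart (c : chart) : Prop :=
  [/\ open (cdom c), open (cmap c @` cdom c),
      (forall p, cdom c p -> cinv c (cmap c p) = p),
      {within cdom c, continuous (cmap c)} &
      {within cmap c @` cdom c, continuous (cinv c)}].

Definition smooth_atlas (A : set chart) : Prop :=
  [/\ (forall c, A c -> is_chart c),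
      (forall p, exists2 c, A c & cdom c p) &
      (forall c c', A c -> A c' -> forall j : 'I_4,
         smooth_on (cmap c @` (cdom c `&` cdom c'))
                   (fun x => cmap c' (cinv c x) 0 j))].

Definition smooth_manifold (A : set chart) : Prop :=
  [/\ hausdorff_space M, @second_countable M & smooth_atlas A].

Definition smooth (A : set chart) (f : M -> R) : Prop :=
  forall c, A c -> smooth_on (cmap c @` cdom c) (f \o cinv c).

Definition tfun := (M -> R) -> R^o.

Definition tangent (A : set chart) (p : M) : set tfun :=
  [set v : tfun |
    [/\ (forall f, ~ smooth A f -> v f = 0),
        (forall f h (c : R), smooth A f -> smooth A h ->
           v (fun q => c * f q + h q) = c * v f + v h) &
        (forall f h, smooth A f -> smooth A h ->
           v (fun q => f q * h q) = f p * v h + h p * v f)]].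

Definition vector_field (A : set chart) (X : M -> tfun) : Prop :=
  (forall p, tangent A p (X p)) /\
  (forall f, smooth A f -> smooth A (fun p => X p f)).

Definition lie (X Y : M -> tfun) : M -> tfun :=
  fun p f => X p (fun q => Y q f) - Y p (fun q => X q f).

End Manifold.

Arguments chart : clear implicits.
Arguments tfun : clear implicits.

(** * Exterior algebra

    [kform E k] is the ambient space of [k]-forms on a subspace [W] of [E]; only
    the values at vectors of [W] are meaningful, see [is_form] and [eq_form]. *)

Definition kform {R : realType} (E : Type) (k : nat) := ('I_k -> E) -> R^o.

Section Exterior.
Context {R : realType}.

Definition is_form (E : lmodType R) (W : set E) (k : nat)
    (w : @kform R E k) : Prop :=
  (forall (v : 'I_k -> E) (a : 'I_k) (c : R) (x y : E),
     (forall b, W (v b)) -> W x -> W y ->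
     w [eta v with a |-> c *: x + y] =
       c * w [eta v with a |-> x] + w [eta v with a |-> y]) /\
  (forall (v : 'I_k -> E) (a b : 'I_k),
     (forall d, W (v d)) -> a != b -> v a = v b -> w v = 0).

Definition eq_form (E : Type) (W : set E) (k : nat) (w w' : @kform R E k) : Prop :=
  forall v : 'I_k -> E, (forall a, W (v a)) -> w v = w' v.

Definition wedge (E : Type) (p q : nat) (w : @kform R E p) (w' : @kform R E q) :
    @kform R E (p + q) :=
  fun v => (p`! * q`!)%N%:R^-1 *
    \sum_(s : 'S_(p + q)%N) (-1) ^+ s * w (fun a => v (s (lshift q a)))
                                    * w' (fun b => v (s (rshift p b))).

(** [ewedge eps [:: i; j; ...]] is e^i /\ e^j /\ ..., where e^i = [eps i]. *)
Fixpoint ewedge (E : Type) (eps : 'I_7 -> E -> R) (I : seq nat) :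
    @kform R E (size I) :=
  match I with
  | [::] => fun _ => 1
  | i :: I' =>
      wedge (fun v : 'I_1 -> E => eps (inord i) (v ord0) : R^o) (@ewedge E eps I')
  end.
Arguments ewedge {E} eps I v.

(** Hodge star of the oriented Euclidean 7-space with direct orthonormal basis
    [b] and dual basis [eps]: with vol = e^0123456,
      ( *w)(v) = 1/k! sum_i w(b_i1, ..., b_ik) vol(b_i1, ..., b_ik, v),
    which is normalised so that w' /\ *w = <w', w> vol. *)
Definition hodge (E : lmodType R) (b : 'I_7 -> E) (eps : 'I_7 -> E -> R)
    (k : nat) (w : @kform R E k) : @kform R E (7 - k) :=
  fun v => (k`!)%:R^-1 *
    \sum_(i : {ffun 'I_k -> 'I_7})
       w (fun a => b (i a)) *
       ewedge eps (iota 0 7)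
         (fun a : 'I_7 => nth 0 (codom (fun c => b (i c)) ++ codom v) a).

End Exterior.

Arguments ewedge {R E} eps I v.

(** * Oriented Riemannian structure and metric connection *)

Section Geometry.
Context {R : realType} {M : topologicalType}.
Local Notation TF := (tfun R M).

Definition riemannian_metric (A : set (chart R M)) (g : M -> TF -> TF -> R) : Prop :=
  [/\ (forall p u v w (c : R), tangent A p u -> tangent A p v -> tangent A p w ->
         g p (c *: u + v) w = c * g p u w + g p v w),
      (forall p u v, tangent A p u -> tangent A p v -> g p u v = g p v u),
      (forall p u, tangent A p u -> u <> 0 -> 0 < g p u u) &
      (forall X Y, vector_field A X -> vector_field A Y ->
         smooth A (fun p => g p (X p) (Y p)))].

(** An orientation is given by a nowhere vanishing 4-form [om]. *)
Definition orientation (A : set (chart R M)) (om : M -> @kform R TF 4) : Prop :=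
  [/\ (forall p, is_form (tangent A p) (om p)),
      (forall X : 'I_4 -> M -> TF, (forall i, vector_field A (X i)) ->
         smooth A (fun p => om p (fun i => X i p))) &
      (forall p, exists2 v : 'I_4 -> TF,
         (forall i, tangent A p (v i)) & om p v <> 0)].

Definition linear_connection (A : set (chart R M))
    (D : (M -> TF) -> (M -> TF) -> (M -> TF)) : Prop :=
  [/\ (forall X Y, vector_field A X -> vector_field A Y -> vector_field A (D X Y)),
      (forall X X' Y f, vector_field A X -> vector_field A X' ->
         vector_field A Y -> smooth A f ->
         D (fun p => f p *: X p + X' p) Y = (fun p => f p *: D X Y p + D X' Y p)),
      (forall X Y Y', vector_field A X -> vector_field A Y -> vector_field A Y' ->
         D X (fun p => Y p + Y' p) = (fun p => D X Y p + D X Y' p)) &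
      (forall X Y f, vector_field A X -> vector_field A Y -> smooth A f ->
         D X (fun p => f p *: Y p) = (fun p => X p f *: Y p + f p *: D X Y p))].

Definition metric_connection (A : set (chart R M)) (g : M -> TF -> TF -> R)
    (D : (M -> TF) -> (M -> TF) -> (M -> TF)) : Prop :=
  linear_connection A D /\
  (forall X Y Z p, vector_field A X -> vector_field A Y -> vector_field A Z ->
     X p (fun q => g q (Y q) (Z q)) =
       g p (D X Y p) (Z p) + g p (Y p) (D X Z p)).

Definition torsion (D : (M -> TF) -> (M -> TF) -> (M -> TF)) (X Y : M -> TF) :
    M -> TF :=
  fun p => D X Y p - D Y X p - lie X Y p.

Definition direct_orthonormal_basis (A : set (chart R M))
    (g : M -> TF -> TF -> R) (om : M -> @kform R TF 4) (p : M)
    (e : 'I_4 -> TF) : Prop :=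
  [/\ (forall i, tangent A p (e i)),
      (forall i j, g p (e i) (e j) = (i == j)%:R),
      (forall v, tangent A p v ->
         exists c : 'I_4 -> R, v = \sum_(i < 4) c i *: e i) &
      0 < om p e].

(** * The unit tangent bundle

    The total space is the set of pairs [(p, u)] with [u] a unit vector of T_pM.
    A tangent vector [X] of SM at [u] is represented by the pair
    (df(X), (f^*D)_X U) in T_pM x u^perp: the first (resp. second) component is
    the image of the horizontal (resp. vertical) part of [X] under the isometry
    H_u = T_pM (resp. V_u = u^perp). *)

Definition unit_tangent (A : set (chart R M)) (g : M -> TF -> TF -> R)
    (p : M) (u : TF) : Prop :=
  tangent A p u /\ g p u u = 1.

Definition tangentSM (A : set (chart R M)) (g : M -> TF -> TF -> R)
    (p : M) (u : TF) : set (TF * TF)%type :=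
  [set x : TF * TF | [/\ tangent A p x.1, tangent A p x.2 & g p x.2 u = 0]].

(** [e_0, ..., e_3] are lifted horizontally; [e_(i+3)] is the vertical vector
    corresponding to [e_i], for [i = 1, 2, 3]. For [e] direct orthonormal with
    [e_0 = u], this is by definition a direct orthonormal basis of T_uSM. *)
Definition adapted_frame (e : 'I_4 -> TF) (i : 'I_7) : TF * TF :=
  if (i < 4)%N then (e (inord i), 0) else (0, e (inord (i - 3))).

Definition dual_coframe (W : set (TF * TF)%type) (b : 'I_7 -> TF * TF)
    (eps : 'I_7 -> TF * TF -> R) : Prop :=
  (forall i (c : R) x y, W x -> W y ->
     eps i (c *: x + y) = c * eps i x + eps i y) /\
  (forall i j, eps i (b j) = (i == j)%:R).

End Geometry.

(** * The G2 structure and the torsion forms in an adapted coframe *)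

Section G2.
Context {R : realType} {E : lmodType R}.
Variables (b : 'I_7 -> E) (eps : 'I_7 -> E -> R).
Local Notation "'e^' I" := (ewedge eps I%N) (at level 8, I at level 0).

Definition mu : @kform R E 1 := e^[:: 0].
Definition beta : @kform R E 2 := e^[:: 1; 4] + e^[:: 2; 5] + e^[:: 3; 6].
Definition alpha : @kform R E 3 := e^[:: 4; 5; 6].
Definition alpha1 : @kform R E 3 :=
  e^[:: 1; 5; 6] + e^[:: 2; 6; 4] + e^[:: 3; 4; 5].
Definition alpha2 : @kform R E 3 :=
  e^[:: 1; 2; 6] + e^[:: 2; 3; 4] + e^[:: 3; 1; 5].

Definition phi : @kform R E 3 := alpha + wedge mu beta - alpha2.

Definition Omega2_14 (W : set E) (w : @kform R E 2) : Prop :=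
  is_form W w /\ eq_form W (wedge w phi) (hodge b eps w).

(** [T i j k] is meaningful for [i, j, k < 4]. *)
Variable T : nat -> nat -> nat -> R.

Definition muT : @kform R E 2 :=
  \sum_(0 <= i < 4) \sum_(i.+1 <= j < 4) T i j 0 *: (e^[:: i; j] : kform E 2).

Definition sigma : @kform R E 3 :=
  \sum_(0 <= i < 4) \sum_(i.+1 <= j < 4)
    (T i j 1 *: (e^[:: i; j; 4] : kform E 3) + T i j 2 *: (e^[:: i; j; 5] : kform E 3)
     + T i j 3 *: (e^[:: i; j; 6] : kform E 3)).

Definition Talpha1 : @kform R E 4 :=
  \sum_(0 <= i < 4) \sum_(i.+1 <= j < 4)
    (T i j 1 *: (e^[:: i; j; 5; 6] : kform E 4)
     + T i j 2 *: (e^[:: i; j; 6; 4] : kform E 4)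
     + T i j 3 *: (e^[:: i; j; 4; 5] : kform E 4)).

Definition dstarphi_tors : @kform R E 5 :=
  - (wedge beta sigma : kform E 5) - (wedge muT alpha1 : kform E 5)
  + (wedge mu Talpha1 : kform E 5).

(** [l] is the index for which (i, j, k, l) is a permutation of (0, 1, 2, 3); [Z]
    is only used at triples for which this permutation is even. *)
Definition Z (i j k : nat) : R :=
  let l := (6 - (i + j + k))%N in T i j j + T i k k + T j k l.

(** (0,1,2,3), (1,0,3,2), (2,3,0,1), (3,2,1,0) are even; the other even
    completions (i, j, k, l) of [i] give the same sum, as they are obtained by a
    cyclic permutation of (j, k, l). *)
Definition W (i : nat) : R :=
  let sum j k l := Z i j k + Z i l j + Z i k l in
  match i with
  | 0 => sum 1 2 3
  | 1 => sum 0 3 2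
  | 2 => sum 3 0 1
  | _ => sum 2 1 0
  end%N.

Definition tau1_tors : @kform R E 1 :=
  3^-1 *: \sum_(0 <= i < 4) W i *: (e^[:: i] : kform E 1).

Definition tau2_tors : @kform R E 2 :=
    (3^-1 * W 3 - Z 3 2 1) *: (e^[:: 0; 6] : kform E 2)
  - (3^-1 * W 2 - Z 2 3 0) *: (e^[:: 1; 6] : kform E 2)
  + (3^-1 * W 1 - Z 1 0 3) *: (e^[:: 2; 6] : kform E 2)
  - (3^-1 * W 0 - Z 0 1 2) *: (e^[:: 3; 6] : kform E 2)
  + (3^-1 * W 2 - Z 2 1 3) *: (e^[:: 0; 5] : kform E 2)
  + (3^-1 * W 3 - Z 3 0 2) *: (e^[:: 1; 5] : kform E 2)
  - (3^-1 * W 0 - Z 0 3 1) *: (e^[:: 2; 5] : kform E 2)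
  - (3^-1 * W 1 - Z 1 2 0) *: (e^[:: 3; 5] : kform E 2)
  + (3^-1 * W 1 - Z 1 3 2) *: (e^[:: 0; 4] : kform E 2)
  - (3^-1 * W 0 - Z 0 2 3) *: (e^[:: 1; 4] : kform E 2)
  - (3^-1 * W 3 - Z 3 1 0) *: (e^[:: 2; 4] : kform E 2)
  + (3^-1 * W 2 - Z 2 0 1) *: (e^[:: 3; 4] : kform E 2).

End G2.

(* Main.v *)
Require Import Defs.
From HB Require Import structures.
From mathcomp Require Import all_boot all_order all_algebra all_fingroup.
From mathcomp Require Import all_classical all_reals all_analysis.
From mathcomp Require Import ring.

Set Implicit Arguments.
Unset Strict Implicit.
Unset Printing Implicit Defensive.

Import Order.TTheory GRing.Theory Num.Theory.
Import numFieldNormedType.Exports.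

Local Open Scope classical_set_scope.
Local Open Scope ring_scope.

(** The manifold enters only through the antisymmetry T_ijk = - T_jik: the forms
    sigma, mu T and T alpha_1 involve T_ijk for i < j alone, while the Z_ijk and
    W_i use both orders. As [g p] is bilinear on tangent vectors only, this antisymmetry
    needs the torsion at [p] to be a tangent vector, hence the Lie bracket of two
    vector fields to be a derivation, which in turn needs products of smooth
    functions to be smooth ([smoothM], [tangent_lie], [metric_torsionC]).

    The rest is linear algebra in the exterior algebra of a 7-space, and holds
    for any family [b] and any [eps] with [eps i (b j) = (i == j)]. A monomial
    e^I is the determinant of the matrix of the e^(I_a)(v_c) ([ewedge_emon]), from
    which follow the three rules of the calculus:
    - e^I /\ e^J = e^(I ++ J), by Laplace expansion ([wedge_emon]);
    - e^I vanishes if I has a repetition, and sorting I costs the sign given by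
      the inversions of I ([emon_dup], [emon_sort]);
    - the Hodge star of e^I is e^J up to the sign of I ++ J, where J is the
      complement of I ([hodge_emon]).
    A form is then represented by a list of coefficients and index lists, on which
    sums, wedge products and the Hodge star are computed ([represents]). Comparing
    the coefficients of sorted monomials, the equations
    tau_2 /\ phi = *tau_2 and (d*phi)_tors = tau_1 /\ *phi + *tau_2 become linear
    identities in the Z_ijk, resp. in the T_ijk ([wedge_tau2_phi],
    [dstarphi_torsE]). *)

(** * Smooth functions and the Lie bracket *)

Lemma near_eq_differentiable (R : numFieldType) (V W : normedModType R)
    (f g : V -> W) (x : V) :
  {near x, f =1 g} -> differentiable f x -> differentiable g x.
Proof.
move=> fg df.
have gE : g \o shift x = cst (g x) + 'd f x +o_ (0 : V) id.
  apply/eqaddoP => _/posnumP[eps]; rewrite -(nbhs_singleton fg).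
  have /eqaddoP/(_ eps%:num (gt0 _)) := diff_locally df.
  have : \forall h \near (0 : V), f (h + x) = g (h + x).
    by move: fg; rewrite (near_shift 0)/= subr0.
  by apply: filterS2 => h /= fgh; rewrite !fctE /= fgh.
have dg : 'd g x = 'd f x :> (V -> W).
  by apply: diff_unique => //; exact: diff_continuous.
by apply/diff_locallyP; rewrite dg; split => //; exact: diff_continuous.
Qed.

Section SmoothProduct.
Variables (R : realType) (A : set 'rV[R]_4).
Hypothesis openA : open A.
Implicit Types f g : 'rV[R]_4 -> R.

Let near_eq_on f g x : (forall y, A y -> f y = g y) -> A x -> {near x, f =1 g}.
Proof.
by move=> fg Ax; apply: filterS (open_nbhs_nbhs (conj openA Ax)) => y /fg.
Qed.

(** The partial derivatives occurring in [Ck_on] are global functions, of which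
    the product rule controls only the restriction to [A]; this lemma makes that
    control sufficient. *)
Lemma eq_Ck_on k f g :
  (forall x, A x -> f x = g x) -> Ck_on k A f -> Ck_on k A g.
Proof.
elim: k f g => [|k IHk] f g fg /=.
  move=> fC x Ax; have := fC x Ax; rewrite /prop_for /continuous_at (fg _ Ax).
  exact: cvg_trans (near_eq_cvg (near_eq_on fg Ax)).
move=> [fD fC]; split=> [x Ax|j].
  by apply: near_eq_differentiable (fD x Ax); exact: near_eq_on.
by apply: IHk (fC j) => x Ax; apply: near_eq_derive; exact: near_eq_on.
Qed.

Lemma Ck_onS k f : Ck_on k.+1 A f -> Ck_on k A f.
Proof.
elim: k f => [|k IHk] f [fD fC] /=.
  by move=> x Ax; exact/differentiable_continuous/fD.
by split => // j; exact/IHk/fC.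
Qed.

Lemma Ck_onD k f g : Ck_on k A f -> Ck_on k A g -> Ck_on k A (f + g).
Proof.
elim: k f g => [|k IHk] f g /=.
  by move=> fC gC x Ax; apply: continuousD; [exact: fC|exact: gC].
move=> [fD fC] [gD gC]; split=> [x Ax|j].
  by apply: differentiableD; [exact: fD|exact: gD].
apply: eq_Ck_on (IHk _ _ (fC j) (gC j)) => x Ax.
by rewrite deriveD //; apply: diff_derivable; [exact: fD|exact: gD].
Qed.

Lemma Ck_onM k f g : Ck_on k A f -> Ck_on k A g -> Ck_on k A (f * g).
Proof.
elim: k f g => [|k IHk] f g.
  by move=> fC gC x Ax; apply: continuousM; [exact: fC|exact: gC].
move=> fS gS; have [fD fC] := fS; have [gD gC] := gS; split=> [x Ax|j].
  by apply: differentiableM; [exact: fD|exact: gD].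
have := Ck_onD (IHk _ _ (Ck_onS fS) (gC j)) (IHk _ _ (Ck_onS gS) (fC j)).
apply: eq_Ck_on => x Ax.
by rewrite deriveM //; apply: diff_derivable; [exact: fD|exact: gD].
Qed.

End SmoothProduct.

Section Tangent.
Variables (R : realType) (M : topologicalType) (A : set (chart R M)).
Hypothesis hA : smooth_atlas A.
Local Notation TF := (tfun R M).

Lemma smoothM (f h : M -> R) :
  smooth A f -> smooth A h -> smooth A (fun q => f q * h q).
Proof.
move=> fS hS c Ac k; have [+ _ _] := hA => /(_ c Ac)[_ oc _ _ _].
exact: (Ck_onM oc (fS c Ac k) (hS c Ac k)).
Qed.

Lemma tangent0_fun (p : M) (v : TF) : tangent A p v -> v (fun=> 0) = 0.
Proof.
move=> [v0 vD _]; have [s0|] := pselect (smooth A (fun=> 0)); last exact: v0.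
have := vD _ _ 1 s0 s0.
by rewrite mul1r addr0 -{1}[v _]addr0 mul1r => /addrI/esym.
Qed.

Lemma tangentZD (p : M) (c : R) (v w : TF) :
  tangent A p v -> tangent A p w -> tangent A p (c *: v + w).
Proof.
have E f : (c *: v + w) f = c * v f + w f by [].
move=> [v0 vD vM] [w0 wD wM]; split=> [f nf|f h d fS hS|f h fS hS].
- by rewrite E v0 // w0 // mulr0 addr0.
- by rewrite !E vD // wD //; ring.
- by rewrite !E vM // wM //; ring.
Qed.

Lemma tangent_zero (p : M) : tangent A p 0.
Proof.
have E f : (0 : TF) f = 0 by [].
by split => *; rewrite !E ?mulr0 ?addr0.
Qed.

Lemma tangentB (p : M) (v w : TF) :
  tangent A p v -> tangent A p w -> tangent A p (v - w).
Proof.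
by move=> vT wT; rewrite addrC -scaleN1r; exact: tangentZD.
Qed.

(** The second-order terms of [X Y] and [Y X] cancel in the Leibniz rule. *)
Lemma tangent_lie (X Y : M -> TF) (p : M) :
  vector_field A X -> vector_field A Y -> tangent A p (lie X Y p).
Proof.
move=> [XT XS] [YT YS]; rewrite /lie.
have [X0 XD XM] := XT p; have [Y0 YD YM] := YT p.
split=> [f nf|f h c fS hS|f h fS hS].
- have E (Z : M -> TF) : (forall q, tangent A q (Z q)) ->
      (fun q => Z q f) = fun=> 0.
    by move=> ZT; apply/funext => q; have [+ _ _] := ZT q; exact.
  by rewrite !E // !(@tangent0_fun p) ?subrr.
- have E (Z : M -> TF) : (forall q, tangent A q (Z q)) ->
      (fun q => Z q (fun r => c * f r + h r)) = fun q => c * Z q f + Z q h.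
    by move=> ZT; apply/funext => q; have [_ + _] := ZT q; exact.
  rewrite !E // XD ?YD; [ring|exact: XS..|exact: YS|exact: YS].
- have E (Z : M -> TF) : (forall q, tangent A q (Z q)) ->
      (fun q => Z q (fun r => f r * h r)) =
      fun q => 1 * (f q * Z q h) + h q * Z q f.
    move=> ZT; apply/funext => q; rewrite mul1r.
    by have [_ _ +] := ZT q; exact.
  rewrite !E // XD ?YD; try by apply: smoothM => //; (apply: XS || apply: YS).
  rewrite !XM ?YM //; try by (apply: XS || apply: YS).
  ring.
Qed.

Lemma torsionC (D : (M -> TF) -> (M -> TF) -> (M -> TF)) (X Y : M -> TF) p :
  torsion D X Y p = - torsion D Y X p.
Proof.
rewrite /torsion; have -> : lie X Y p = - lie Y X p.
  by apply/funext => f; rewrite /lie !fctE opprB.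
by rewrite [RHS]opprD [in RHS]opprB.
Qed.

Lemma metricNl (g : M -> TF -> TF -> R) (p : M) (v w : TF) :
  riemannian_metric A g -> tangent A p v -> tangent A p w ->
  g p (- v) w = - g p v w.
Proof.
move=> [gD _ _ _] vT wT; have T0 := tangent_zero p.
have g0 : g p 0 w = 0.
  have := gD p _ _ _ 1 T0 T0 wT.
  by rewrite scaler0 addr0 mul1r -{1}[g p 0 w]addr0 => /addrI/esym.
by rewrite -scaleN1r -[_ *: v]addr0 gD // g0 addr0 mulN1r.
Qed.

(** The torsion is antisymmetric as a functional for every [D]; the hypotheses make
    it a tangent vector, so that the sign can be taken out of [g]. *)
Lemma metric_torsionC (g : M -> TF -> TF -> R)
    (D : (M -> TF) -> (M -> TF) -> (M -> TF)) (X Y : M -> TF) (p : M) (w : TF) :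
  riemannian_metric A g -> linear_connection A D ->
  vector_field A X -> vector_field A Y -> tangent A p w ->
  g p (torsion D X Y p) w = - g p (torsion D Y X p) w.
Proof.
move=> gR [DV _ _ _] XV YV wT; rewrite torsionC (metricNl gR) //.
apply: tangentB; last exact: tangent_lie.
by apply: tangentB; [have [+ _] := DV _ _ YV XV|have [+ _] := DV _ _ XV YV]; exact.
Qed.

End Tangent.

(** * Exterior monomials as determinants *)

Section BlockPerm.
Variables (p q : nat) (s : 'S_p) (t : 'S_q).

Definition block_perm_fun (i : 'I_(p + q)) : 'I_(p + q) :=
  match fintype.split i with inl a => lshift q (s a) | inr c => rshift p (t c) end.

Lemma block_perm_inj : injective block_perm_fun.
Proof.
move=> i j; rewrite /block_perm_fun.
case: (split_ordP i) => a ->; case: (split_ordP j) => c ->.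
- by move=> /lshift_inj/perm_inj ->.
- by move=> /eqP; rewrite eq_lrshift.
- by move=> /eqP; rewrite eq_rlshift.
- by move=> /rshift_inj/perm_inj ->.
Qed.

Definition block_perm : 'S_(p + q) := perm block_perm_inj.

Lemma block_perm_lshift a : block_perm (lshift q a) = lshift q (s a).
Proof. by rewrite permE /block_perm_fun (unsplitK (inl a)). Qed.

Lemma block_perm_rshift c : block_perm (rshift p c) = rshift p (t c).
Proof. by rewrite permE /block_perm_fun (unsplitK (inr c)). Qed.

Lemma sign_block_perm (R : comNzRingType) :
  (-1) ^+ block_perm = (-1) ^+ s * (-1) ^+ t :> R.
Proof.
rewrite -!det_perm -(det_ublock _ 0); congr (\det _).
apply/matrixP => i j; rewrite [LHS]mxE [in LHS]mxE.
case: (split_ordP i) => a ->; case: (split_ordP j) => c ->.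
- by rewrite block_mxEul !mxE block_perm_lshift eq_lshift.
- by rewrite block_mxEur !mxE block_perm_lshift eq_lrshift.
- by rewrite block_mxEdl !mxE block_perm_rshift eq_rlshift.
- by rewrite block_mxEdr !mxE block_perm_rshift eq_rshift.
Qed.

End BlockPerm.

(** Expansion along the first [p] rows, summed over all permutations rather than
    over the sets of [p] columns, which is why each term is counted [p`! * q`!]
    times: this is the normalisation of [wedge]. Once both minors are expanded over
    permutations t and t', reindexing s by their direct sum absorbs t and t', and
    each pair (t, t') contributes [\det A]. *)
Lemma det_laplace (R : comNzRingType) (p q : nat) (A : 'M[R]_(p + q)) :
  (p`! * q`!)%:R * \det A =
  \sum_(s : 'S_(p + q)) (-1) ^+ s
    * \det (\matrix_(a < p, c < p) A (lshift q a) (s (lshift q c)))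
    * \det (\matrix_(a < q, c < q) A (rshift p a) (s (rshift p c))).
Proof.
transitivity (\sum_(t : 'S_p) \sum_(t' : 'S_q) \det A).
  by rewrite !sumr_const !card_Sn -mulrnA mulr_natl mulnC.
under [RHS]eq_bigr => s _.
  rewrite -mulrA big_distrlr mulr_sumr /=.
  under eq_bigr => t _ do rewrite mulr_sumr.
  over.
rewrite [RHS]exchange_big; apply: eq_bigr => t _ /=.
rewrite [RHS]exchange_big; apply: eq_bigr => t' _ /=.
rewrite [RHS](reindex_inj (mulgI (block_perm t t')^-1)%g) /=.
apply: eq_bigr => s _.
set P := \prod_(i < p) _; set Q := \prod_(i < q) _; rewrite big_split_ord /=.
have -> : P = \prod_(i < p) A (lshift q i) (s (lshift q i)).
  by apply: eq_bigr => i _; rewrite mxE permM -(block_perm_lshift t t') permK.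
have -> : Q = \prod_(i < q) A (rshift p i) (s (rshift p i)).
  by apply: eq_bigr => i _; rewrite mxE permM -(block_perm_rshift t t') permK.
rewrite odd_permM odd_permV signr_addb sign_block_perm.
have sq (b : bool) : (-1) ^+ b * (-1) ^+ b = 1 :> R by rewrite -signr_addb addbb.
have := sq t; have := sq t'; move: (_ ^+ t) (_ ^+ t') (_ ^+ s) => x y z yy xx.
rewrite -[LHS]mul1r -{1}[1 in LHS]mulr1 -{1}xx -yy.
by ring.
Qed.

Section Monomials.
Variables (R : realType) (E : lmodType R) (eps : 'I_7 -> E -> R).
Implicit Types (I J : seq nat) (V : seq E).

(** The value of e^I at the first [size I] vectors of [V]. Vectors are given as a
    list, so that concatenating index lists involves no cast between types
    ['I_n -> E]. *)
Definition emon I V : R :=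
  \det (\matrix_(a < size I, c < size I) eps (inord (nth 0%N I a)) (nth 0 V c)).

Definition emon_form k I : @kform R E k := fun v => emon I (codom v).

Lemma emonE n I V : size I = n ->
  emon I V = \det (\matrix_(a < n, c < n) eps (inord (nth 0%N I a)) (nth 0 V c)).
Proof. by move=> <-. Qed.

Lemma eq_emon I V V' :
  (forall a, (a < size I)%N -> nth 0 V a = nth 0 V' a) -> emon I V = emon I V'.
Proof.
by move=> VV'; congr (\det _); apply/matrixP => a c; rewrite !mxE VV'.
Qed.

Lemma nth_codom_ord n (v : 'I_n -> E) (a : 'I_n) : nth 0 (codom v) a = v a.
Proof. by rewrite codomE (nth_map a) ?size_enum_ord // nth_ord_enum. Qed.

Lemma emonE_form I V : emon I V = @emon_form (size I) I (fun c => nth 0 V c).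
Proof.
by apply: eq_emon => a aI; rewrite (nth_codom_ord _ (Ordinal aI)).
Qed.

Lemma wedge_emon p q I J : size I = p -> size J = q ->
  wedge (@emon_form p I) (@emon_form q J) = @emon_form (p + q) (I ++ J).
Proof.
move=> sI sJ; apply/funext => v; rewrite /wedge /emon_form.
have /emonE -> : size (I ++ J) = (p + q)%N by rewrite size_cat sI sJ.
set A := \matrix_(_, _) _.
have nz : (p`! * q`!)%:R != 0 :> R by rewrite pnatr_eq0 -lt0n muln_gt0 !fact_gt0.
apply: (canLR (mulKf nz)); rewrite det_laplace; apply: eq_bigr => s _.
rewrite (emonE _ sI) (emonE _ sJ); congr (_ * _); first congr (_ * _).
  congr (\det _); apply/matrixP => a c; rewrite !mxE !nth_codom_ord nth_cat sI /=.
  by rewrite ltn_ord.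
congr (\det _); apply/matrixP => a c; rewrite !mxE !nth_codom_ord nth_cat sI /=.
by rewrite ltnNge leq_addr addKn.
Qed.

Lemma ewedge_emon I : ewedge eps I = @emon_form (size I) I.
Proof.
elim: I => [|i I IHI]; first by apply/funext => v; rewrite /emon_form /emon det_mx00.
have e1 : (fun v : 'I_1 -> E => eps (inord i) (v ord0)) = @emon_form 1 [:: i].
  by apply/funext => v; rewrite /emon_form /emon det_mx11 mxE (nth_codom_ord v).
by rewrite /= IHI e1; exact: (@wedge_emon 1 (size I) [:: i] I erefl erefl).
Qed.

(** Obtained from e^(x :: I) = e^x /\ e^I, it lets the sign rules below be proved
    by induction on the index list. *)
Lemma eq_emon_cons (c : R) x I J : size I = size J ->
  (forall V, emon I V = c * emon J V) ->
  forall V, emon (x :: I) V = c * emon (x :: J) V.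
Proof.
move=> sIJ IJ V.
have wE K : size K = size J -> emon (x :: K) V =
    wedge (@emon_form 1 [:: x]) (@emon_form (size J) K) (fun a => nth 0 V a).
  by move=> sK; rewrite wedge_emon // emonE_form /= sK.
rewrite !wE // /wedge mulrCA; congr (_ * _); rewrite mulr_sumr.
by apply: eq_bigr => s _; rewrite [X in _ * X = _]IJ mulrCA.
Qed.

Lemma emon_swap x y I V : emon [:: x, y & I] V = - emon [:: y, x & I] V.
Proof.
rewrite /emon; set A := \matrix_(_, _) _; set B := \matrix_(_, _) _.
pose i0 : 'I_(size [:: x, y & I]) := ord0.
pose i1 : 'I_(size [:: x, y & I]) := lift ord0 ord0.
suff -> : A = xrow i0 i1 B.
  by rewrite xrowE det_mulmx /tperm_mx det_perm odd_tperm mulN1r.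
apply/matrixP => a c; rewrite !mxE.
case: tpermP => [-> //|-> //|].
case: a => [[|[|a]] ha] //= n0 n1; first by case: n0; apply/val_inj.
by case: n1; apply/val_inj.
Qed.

Lemma emon_dup I V : ~~ uniq I -> emon I V = 0.
Proof.
move=> /(uniqPn 0%N)[i [j [ij jI eqij]]]; have iI := ltn_trans ij jI.
apply: (@determinant_alternate _ _ _ (Ordinal iI) (Ordinal jI)).
  by rewrite -val_eqE /= ltn_eqF.
by move=> c; rewrite !mxE /= eqij.
Qed.

Lemma emon_move x I J V :
  emon (x :: I ++ J) V = (-1) ^+ size I * emon (I ++ x :: J) V.
Proof.
elim: I V => [|y I IHI] V /=; first by rewrite mul1r.
rewrite emon_swap exprS mulN1r mulNr; congr (- _).
by apply: (eq_emon_cons y _ IHI); rewrite /= !size_cat /= addnS.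
Qed.

Fixpoint inversions I : nat :=
  if I is x :: I' then (count (fun y => y < x) I' + inversions I')%N else 0.

(** Insertion sort: in e^x /\ e^s with s sorted, the factor e^x moves past the
    factors e^y with y < x, each exchange costing a sign. *)
Lemma emon_sort I V :
  uniq I -> emon I V = (-1) ^+ inversions I * emon (sort leq I) V.
Proof.
elim: I V => [|x I IHI] V /=; first by rewrite mul1r.
move=> /andP[xI uI].
rewrite (eq_emon_cons x _ (fun V => IHI V uI)) ?size_sort // exprD -mulrA mulrCA.
congr (_ * _); set s := sort leq I.
have us : uniq s by rewrite sort_uniq.
have ss : sorted leq s by apply: sort_sorted; exact: leq_total.
set L := [seq y <- s | (y < x)%N]; set U := [seq y <- s | ~~ (y < x)%N].
have sE : s = L ++ U.
  apply: (sorted_eq leq_trans anti_leq) => //; last first.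
    by rewrite perm_sym perm_filterC.
  rewrite (sorted_pairwise leq_trans) pairwise_cat -!(sorted_pairwise leq_trans).
  rewrite !sorted_filter ?andbT //; try exact: leq_trans.
  apply/allrelP => y z; rewrite !mem_filter -leqNgt => /andP[yx _] /andP[xz _].
  exact: leq_trans (ltnW yx) xz.
have -> : sort leq (x :: I) = L ++ x :: U.
  apply: (sorted_eq leq_trans anti_leq).
  - by apply: sort_sorted; exact: leq_total.
  - rewrite (sorted_pairwise leq_trans) pairwise_cat /= -!(sorted_pairwise leq_trans).
    rewrite !sorted_filter ?andbT //; try exact: leq_trans.
    apply/andP; split; last by apply/allP => z; rewrite mem_filter -leqNgt => /andP[].
    apply/allrelP => y z; rewrite inE !mem_filter -leqNgt => /andP[yx _].
    move=> /orP[/eqP ->|/andP[xz _]]; first exact: ltnW.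
    exact: leq_trans (ltnW yx) xz.
  - rewrite perm_sort perm_sym -cat1s perm_catCA /= perm_cons -sE.
    by rewrite perm_sort.
rewrite [in LHS]sE emon_move; congr (_ ^+ _ * _).
by rewrite size_filter; have /seq.permP -> : perm_eq s I by rewrite perm_sort.
Qed.

Section Hodge.
Variable b : 'I_7 -> E.
Hypothesis epsb : forall i j, eps i (b j) = (i == j)%:R.

Let eps_inord i j : (i < 7)%N -> (j < 7)%N ->
  eps (inord i) (b (inord j)) = (i == j)%:R.
Proof. by move=> i7 j7; rewrite epsb -val_eqE /= !inordK. Qed.

(** The matrix of e^(I ++ J) at these vectors is block triangular: its upper left
    block is a permutation matrix, its lower left block vanishes since I and J are
    disjoint, and its lower right block is the matrix of e^J. *)
Lemma emon_frame k I J V (s : 'S_k) :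
  size I = k -> uniq (I ++ J) -> all (fun i => i < 7)%N (I ++ J) ->
  emon (I ++ J) (codom (fun c => b (inord (nth 0%N I (s c)))) ++ V) =
  (-1) ^+ s * emon J V.
Proof.
move=> sI; rewrite cat_uniq all_cat => /and3P[uI IJ uJ] /andP[I7 J7].
have /emonE -> : size (I ++ J) = (k + size J)%N by rewrite size_cat sI.
have nI7 (a : 'I_k) : (nth 0 I a < 7)%N by apply: (allP I7); rewrite mem_nth ?sI.
have nJ7 (a : 'I_(size J)) : (nth 0 J a < 7)%N by apply: (allP J7); rewrite mem_nth.
set v := fun c : 'I_k => _; have sv : size (codom v) = k.
  by rewrite size_codom card_ord.
rewrite -(odd_permV s) -det_perm.
rewrite -(det_ublock _ (\matrix_(a, c) eps (inord (nth 0%N I a)) (nth 0 V c))).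
congr (\det _); apply/matrixP => i j; rewrite [LHS]mxE.
case: (split_ordP i) => a ->; case: (split_ordP j) => c ->.
- rewrite block_mxEul !mxE !nth_cat sv sI /= !ltn_ord nth_codom_ord.
  rewrite eps_inord // nth_uniq ?sI //; congr (nat_of_bool _)%:R.
  by rewrite -(inj_eq (@perm_inj _ s)) permKV.
- rewrite block_mxEur !mxE !nth_cat sv sI /= ltn_ord ltnNge leq_addr /=.
  by rewrite addKn.
- rewrite block_mxEdl !mxE !nth_cat sv sI /= ltn_ord ltnNge leq_addr /= addKn.
  rewrite nth_codom_ord eps_inord //; case: eqP => // eqn.
  case/negP: IJ; apply/hasP; exists (nth 0%N J a); first by rewrite mem_nth.
  by rewrite eqn mem_nth ?sI.
- rewrite block_mxEdr !mxE !nth_cat sv sI /= !ltnNge !leq_addr /=.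
  by rewrite !addKn.
Qed.

(** In the sum defining [hodge], e^I(b_i1, ..., b_ik) is nonzero only when i lists
    the elements of I in the order given by some permutation s; it is then the sign
    of s, which appears once more in vol(b_i1, ..., b_ik, v) by [emon_frame]. So
    the k! permutations contribute equally, and 1/k! normalises their sum. *)
Lemma hodge_emon k I J (v : 'I_(7 - k) -> E) :
  size I = k -> perm_eq (I ++ J) (iota 0 7) ->
  hodge b eps (@emon_form k I) v = (-1) ^+ inversions (I ++ J) * emon J (codom v).
Proof.
move=> sI pIJ.
have uIJ : uniq (I ++ J) by rewrite (perm_uniq pIJ) iota_uniq.
have aIJ : all (fun i => i < 7)%N (I ++ J).
  by rewrite (perm_all _ pIJ); apply/allP => i; rewrite mem_iota.
have volE V : emon (iota 0 7) V = (-1) ^+ inversions (I ++ J) * emon (I ++ J) V.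
  rewrite (emon_sort _ uIJ) mulrA -signr_odd -signr_addb addbb mul1r.
  by congr emon; apply: (sorted_eq leq_trans anti_leq);
    rewrite ?iota_sorted ?(sort_sorted leq_total) // perm_sym perm_sort.
have kfact : (k`!)%:R != 0 :> R by rewrite pnatr_eq0 -lt0n fact_gt0.
rewrite /hodge; apply: (canLR (mulKf kfact)).
pose F (w : 'I_k -> E) := emon (iota 0 7) (codom w ++ codom v).
(* Expanding e^I(b_i) over permutations: a product of Kronecker symbols tests
   whether i lists the elements of I in the order prescribed by s. *)
transitivity (\sum_(i : {ffun 'I_k -> 'I_7}) \sum_(s : 'S_k)
    (-1) ^+ s * (i == [ffun c => inord (nth 0%N I (s^-1 c)%g)])%:R
      * F (fun c => b (i c))).
  apply: eq_bigr => i _; rewrite -mulr_suml; congr (_ * _); last first.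
    rewrite ewedge_emon; apply: eq_emon => a a7.
    by rewrite (nth_codom_ord _ (Ordinal a7)).
  rewrite /emon_form (emonE _ sI); apply: eq_bigr => s _; congr (_ * _).
  under eq_bigr => a _ do rewrite mxE nth_codom_ord epsb.
  case: eqP => [->|ni].
    by rewrite big1 // => a _; rewrite ffunE permK eqxx.
  apply/eqP; rewrite prodf_seq_eq0; apply/negPn/negP => /hasPn nz.
  apply: ni; apply/ffunP => c; rewrite ffunE.
  have := nz (s^-1 c)%g (mem_index_enum _); rewrite permKV /=.
  by rewrite pnatr_eq0 eqb0 negbK => /eqP ->.
rewrite exchange_big /=.
transitivity (\sum_(s : 'S_k) (-1) ^+ inversions (I ++ J) * emon J (codom v)).
  apply: eq_bigr => s _; rewrite (bigD1 [ffun c => inord (nth 0%N I (s^-1 c)%g)]) //=.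
  rewrite [X in _ + X]big1 ?addr0 => [|i /negPf ->]; last by rewrite mulr0 mul0r.
  rewrite eqxx mulr1 /F volE.
  have -> : codom (fun c => b ([ffun c0 => inord (nth 0%N I (s^-1 c0)%g)] c)) =
      codom (fun c => b (inord (nth 0%N I (s^-1 c)%g))).
    by apply: eq_codom => c; rewrite ffunE.
  by rewrite emon_frame // odd_permV mulrCA (mulrA (_ ^+ s)) -signr_addb addbb mul1r.
by rewrite sumr_const card_Sn mulr_natl.
Qed.

End Hodge.

End Monomials.

(** * Calculus of combinations of monomials *)

Section Combinations.
Variables (R : realType) (E : lmodType R) (eps : 'I_7 -> E -> R).
Implicit Types (I : seq nat) (s : seq (R * seq nat)).

Definition comb k s : @kform R E k :=
  fun v => \sum_(t <- s) t.1 * emon eps t.2 (codom v).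

(** The length condition makes the concatenation of index lists a faithful model of
    [wedge]: an index list of the wrong length would read vectors beyond the
    arguments of the form, or ignore some of them. *)
Definition represents k (w : @kform R E k) s : Prop :=
  all (fun t => size t.2 == k) s /\ w = comb s.

Lemma represents_ewedge I : represents (ewedge eps I) [:: (1, I)].
Proof.
split; first by rewrite /= eqxx.
by apply/funext => v; rewrite ewedge_emon /comb big_seq1 mul1r.
Qed.

Lemma representsD k (w w' : @kform R E k) s s' :
  represents w s -> represents w' s' -> represents (w + w') (s ++ s').
Proof.
move=> [ks ->] [ks' ->]; split; first by rewrite all_cat ks.
by apply/funext => v; rewrite /comb big_cat.
Qed.

Lemma representsZ k (c : R) (w : @kform R E k) s :
  represents w s -> represents (c *: w) [seq (c * t.1, t.2) | t <- s].
Proof.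
move=> [ks ->]; split; first by rewrite all_map.
apply/funext => v; rewrite /comb big_map [LHS]mulr_sumr.
by apply: eq_bigr => t _; rewrite mulrA.
Qed.

Lemma representsN k (w : @kform R E k) s :
  represents w s -> represents (- w) [seq (- t.1, t.2) | t <- s].
Proof.
move=> /(representsZ (-1)); rewrite scaleN1r; congr represents.
by apply: eq_map => t; rewrite mulN1r.
Qed.

Lemma represents_sum k (J : Type) (r : seq J) (F : J -> @kform R E k)
    (S : J -> seq (R * seq nat)) :
  (forall j, represents (F j) (S j)) ->
  represents (\sum_(j <- r) F j) (flatten [seq S j | j <- r]).
Proof.
move=> FS; elim: r => [|j r IHr].
  by rewrite big_nil; split => //; apply/funext => v; rewrite /comb big_nil.
by rewrite big_cons; exact: representsD.
Qed.

Lemma represents_wedge p q (w : @kform R E p) (w' : @kform R E q) s s' :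
  represents w s -> represents w' s' ->
  represents (wedge w w')
    [seq (t.1 * t'.1, t.2 ++ t'.2) | t <- s, t' <- s'].
Proof.
move=> [ks ->] [ks' ->]; split.
  apply/allP => _ /allpairsP[[t t'] /= [ts ts' ->]] /=.
  by rewrite size_cat (eqP (allP ks _ ts)) (eqP (allP ks' _ ts')).
apply/funext => v; rewrite /comb big_allpairs_dep /=.
transitivity (\sum_(t <- s) \sum_(t' <- s')
    (t.1 * t'.1) * wedge (@emon_form R E eps p t.2) (@emon_form R E eps q t'.2) v).
  rewrite /wedge /emon_form.
  under [RHS]eq_bigr => t _ do under eq_bigr => t' _ do rewrite mulrCA mulr_sumr.
  under [RHS]eq_bigr => t _ do rewrite -mulr_sumr exchange_big.
  rewrite -[RHS]mulr_sumr exchange_big /=; congr (_ * _); apply: eq_bigr => x _.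
  rewrite -mulrA big_distrlr mulr_sumr; apply: eq_bigr => t _.
  rewrite mulr_sumr; apply: eq_bigr => t' _ /=.
  by rewrite mulrACA [LHS]mulrCA -!mulrA.
apply: eq_big_seq => t ts; apply: eq_big_seq => t' ts'.
by rewrite (wedge_emon _ (eqP (allP ks _ ts)) (eqP (allP ks' _ ts'))).
Qed.

Definition complement I := [seq i <- iota 0 7 | i \notin I].

Definition hodge_sign I := odd (inversions (I ++ complement I)).

Lemma represents_hodge k (b : 'I_7 -> E) (w : @kform R E k) s :
  (forall i j, eps i (b j) = (i == j)%:R) ->
  represents w s ->
  all (fun t => perm_eq (t.2 ++ complement t.2) (iota 0 7)) s ->
  represents (hodge b eps w)
    [seq ((if hodge_sign t.2 then - t.1 else t.1), complement t.2) | t <- s].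
Proof.
move=> epsb [ks ->] cs; split.
  rewrite all_map; apply/allP => t ts /=.
  rewrite -(size_iota 0 7) -(perm_size (allP cs _ ts)) size_cat.
  by rewrite (eqP (allP ks _ ts)) addKn.
apply/funext => v; rewrite /comb big_map.
transitivity (\sum_(t <- s) t.1 * hodge b eps (@emon_form R E eps k t.2) v).
  rewrite /hodge /emon_form.
  under [RHS]eq_bigr => t _ do rewrite mulrCA mulr_sumr.
  rewrite -[RHS]mulr_sumr exchange_big; congr (_ * _); apply: eq_bigr => i _.
  rewrite mulr_suml; apply: eq_bigr => t _.
  exact: esym (mulrA _ _ _).
apply: eq_big_seq => t ts.
rewrite (hodge_emon epsb v (eqP (allP ks _ ts)) (allP cs _ ts)) /= -signr_odd.
by rewrite /hodge_sign; case: odd; rewrite ?mulN1r ?mul1r ?mulrN ?mulNr.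
Qed.

Definition normal_form I :=
  if uniq I then Some (odd (inversions I), sort leq I) else None.

Definition signed_value (x : seq nat -> R) (c : R) (o : option (bool * seq nat)) :=
  match o with
  | Some (sg, J) => if sg then - (c * x J) else c * x J
  | None => 0
  end.

(** The linear combination [s] with every sorted monomial e^J replaced by an
    arbitrary scalar [x J]. *)
Definition value (x : seq nat -> R) s : R :=
  foldr (fun t r => signed_value x t.1 (normal_form t.2) + r) 0 s.

(** Treating the sorted monomials as independent unknowns, this reduces an equality
    of forms to an identity of polynomials in the coefficients and the [x J]. *)
Lemma represents_eq k (w w' : @kform R E k) s s' :
  represents w s -> represents w' s' ->
  (forall x, value x s = value x s') -> w = w'.
Proof.
have combE u v : comb u v = value (fun I => emon eps I (codom v)) u.
  elim: u => [|[c I] u IHu]; first by rewrite /comb big_nil.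
  rewrite /comb big_cons /= -[X in _ = _ + X]IHu; congr (_ + _).
  rewrite /normal_form; case: ifPn => [uI|/emon_dup ->]; last by rewrite mulr0.
  rewrite (emon_sort _ _ uI) -signr_odd /=.
  by case: odd; rewrite ?mul1r // mulN1r mulrN.
by move=> [_ ->] [_ ->] ss'; apply/funext => v; rewrite !combE.
Qed.

End Combinations.

Section Form.
Variables (R : realType) (E : lmodType R) (eps : 'I_7 -> E -> R) (W : set E).
Hypothesis epsZD : forall i (c : R) x y,
  W x -> W y -> eps i (c *: x + y) = c * eps i x + eps i y.

Lemma is_form_represents k (w : @kform R E k) s :
  represents eps w s -> is_form W w.
Proof.
move=> [ks ->].
(* The vectors index the rows, so that varying one of them varies a row. *)
have emonT I (v : 'I_k -> E) : size I == k -> emon eps I (codom v) =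
    \det (\matrix_(c < k, a < k) eps (inord (nth 0%N I a)) (v c)).
  move=> /eqP sI; rewrite (emonE _ _ sI) -det_tr; congr (\det _).
  by apply/matrixP => c a; rewrite !mxE nth_codom_ord.
split=> [v a c x y Wv Wx Wy|v a d Wv ad vad]; rewrite /comb.
  rewrite mulr_sumr -big_split; apply: eq_big_seq => t ts /=.
  have kt := allP ks _ ts; rewrite !emonT //=.
  rewrite [X in _ = X + _]mulrCA -mulrDr; congr (_ * _).
  rewrite -[X in _ = _ + X]mul1r; apply: (@determinant_multilinear _ _ _ _ _ a).
  - by apply/rowP => j; rewrite !mxE /= eqxx mul1r epsZD.
  - by apply/matrixP => i j; rewrite !mxE /= eq_sym (negPf (neq_lift _ _)).
  - by apply/matrixP => i j; rewrite !mxE /= eq_sym (negPf (neq_lift _ _)).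
apply: big1_seq => t /andP[_ ts]; have kt := allP ks _ ts; rewrite emonT //.
by rewrite (determinant_alternate ad) ?mulr0 // => j; rewrite !mxE vad.
Qed.

End Form.

(** * The torsion identities *)

(** Builds the representing list of a form by recursion on its expression; the list
    is an existential variable of the goal. The degrees and the index list are
    given explicitly because degrees such as [1 + 2] and [3] are only
    convertible. *)
Ltac represent := repeat
  lazymatch goal with
  | |- represents _ (_ + _) _ => refine (representsD _ _)
  | |- represents _ (- _) _ => refine (representsN _)
  | |- represents _ (_ *: _) _ => refine (representsZ _ _)
  | |- represents _ (\sum_(_ <- _) _) _ => refine (represents_sum _ _) => ?
  | |- represents ?e (@wedge _ _ ?p ?q ?w ?w') _ =>
      refine (@represents_wedge _ _ e p q w w' _ _ _ _)
  | |- represents ?e (ewedge _ ?I) _ => exact (represents_ewedge e I)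
  end.

(** Expands both [value]s into explicit sums. The operations on index lists are
    evaluated separately, since their arguments are closed, whereas the
    coefficients must remain symbolic. *)
Ltac compute_values :=
  cbv [value foldr cat allpairs_dep map flatten fst snd index_iota iota
       subn subn_rec Nat.sub];
  repeat
    match goal with
    | |- context [normal_form ?I] =>
        let o := eval vm_compute in (normal_form I) in
        change (normal_form I) with o
    | |- context [hodge_sign ?I] =>
        let o := eval vm_compute in (hodge_sign I) in
        change (hodge_sign I) with o
    end;
  cbv [signed_value].

Section Identities.
Variables (R : realType) (E : lmodType R) (b : 'I_7 -> E) (eps : 'I_7 -> E -> R).
Hypothesis epsb : forall i j, eps i (b j) = (i == j)%:R.
Variable T : nat -> nat -> nat -> R.

(** The condition amounts to each W_i being the sum of the three Z_ijk that occur
    with it in [tau2_tors], so the Z_ijk are left unexpanded. *)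
Lemma wedge_tau2_phi :
  wedge (tau2_tors eps T) (phi eps) = hodge b eps (tau2_tors eps T).
Proof.
apply: (@represents_eq _ _ eps).
- by rewrite /tau2_tors /phi /alpha /mu /beta /alpha2; represent.
- refine (@represents_hodge _ _ _ 2 _ _ _ epsb _ _);
    [by rewrite /tau2_tors; represent|by []].
move=> x; compute_values.
rewrite /W.
by field.
Qed.

Hypothesis antisymT : forall i j k, T i j k = - T j i k.

Lemma dstarphi_torsE :
  dstarphi_tors eps T =
  wedge (tau1_tors eps T) (hodge b eps (phi eps)) + hodge b eps (tau2_tors eps T).
Proof.
apply: (@represents_eq _ _ eps).
- by rewrite /dstarphi_tors /muT /sigma /Talpha1 /mu /beta /alpha1; represent.
- apply: representsD.
    apply: (@represents_wedge _ _ _ 1 4).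
      by rewrite /tau1_tors; represent.
    refine (@represents_hodge _ _ _ 3 _ _ _ epsb _ _);
      [by rewrite /phi /alpha /mu /beta /alpha2; represent|by []].
  refine (@represents_hodge _ _ _ 2 _ _ _ epsb _ _);
    [by rewrite /tau2_tors; represent|by []].
move=> x; compute_values.
cbv [W Z addn addn_rec Nat.add subn subn_rec Nat.sub].
rewrite !(antisymT 1 0) !(antisymT 2 0) !(antisymT 3 0).
rewrite !(antisymT 2 1) !(antisymT 3 1) !(antisymT 3 2).
by field.
Qed.

End Identities.

Theorem proposition3p2 (R : realType) (M : topologicalType)
    (A : set (chart R M)) (hM : smooth_manifold A)
    (g : M -> tfun R M -> tfun R M -> R) (hg : riemannian_metric A g)
    (om : M -> @kform R (tfun R M) 4) (hom : orientation A om)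
    (D : (M -> tfun R M) -> (M -> tfun R M) -> (M -> tfun R M))
    (hD : metric_connection A g D)
    (p : M) (u : tfun R M) (hu : unit_tangent A g p u)
    (e : 'I_4 -> tfun R M) (he : direct_orthonormal_basis A g om p e)
    (he0 : e ord0 = u)
    (eps : 'I_7 -> tfun R M * tfun R M -> R)
    (heps : dual_coframe (tangentSM A g p u) (adapted_frame e) eps)
    (X : 'I_4 -> M -> tfun R M) (hX : forall i, vector_field A (X i))
    (hXe : forall i, X i p = e i) :
  let b := adapted_frame e in
  let T := fun i j k : nat =>
    g p (torsion D (X (inord i)) (X (inord j)) p) (e (inord k)) in
  Omega2_14 b eps (tangentSM A g p u) (tau2_tors eps T) /\
  eq_form (tangentSM A g p u)
    (dstarphi_tors eps T)
    (wedge (tau1_tors eps T) (hodge b eps (phi eps)) + hodge b eps (tau2_tors eps T)).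
Proof.
move=> b T.
have [epsZD epsb] := heps.
have antisymT i j k : T i j k = - T j i k.
  have [_ _ hA] := hM; have [hL _] := hD; have [eT _ _ _] := he.
  exact: (metric_torsionC hA).
split; last by move=> v _; rewrite (dstarphi_torsE epsb antisymT).
split; last by move=> v _; rewrite (wedge_tau2_phi epsb).
by apply: (is_form_represents epsZD); rewrite /tau2_tors; represent.
Qed.
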